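(* Let $A\subseteq\mathbb{N}$ be a set such that $2^{-A}$ is left-computable. The following are equivalent: (1) $2^{-A}$ is regainingly approximable. (2) There exists a uniformly computable approximation $(A_n)_n$ of $A$ from the left such that $A\cap\{0,\ldots,n-1\}=A_n$ for infinitely many $n$. (3) For every uniformly computable approximation $(B_n)_n$ of $A$ from the left there exists a computable increasing function $s\colon\mathbb{N}\to\mathbb{N}$ such that $A\cap\{0,\ldots,n-1\}=B_{s(n)}\cap\{0,\ldots,n-1\}$ for infinitely many $n$.
   Context: For $D\subseteq\mathbb{N}$ let $2^{-D}:=\sum_{a\in D}2^{-(a+1)}$. A real is left-computable if it is the limit of a computable nondecreasing sequence of rationals. A real number $\alpha$ is regainingly approximable if there exists a computable nondecreasing sequence of rational numbers $(a_n)_n$ converging to $\alpha$ with $\alpha-a_n<2^{-n}$ for infinitely many $n$. A sequence $(A_n)_n$ of finite subsets of $\mathbb{N}$ is a strong array if $n\mapsto\sum_{i\in A_n}2^i$ is computable. A strong array $(A_n)_n$ is a uniformly computable approximation from the left of $A\subseteq\mathbb{N}$ if for all $n$: $A_n\subseteq\{0,\ldots,n-1\}$, $2^{-A_n}\le 2^{-A_{n+1}}$, and for all $i$: $\lim_{n\to\infty}A_n(i)=A(i)$ (identifying sets with characteristic functions). *)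

(* Defs.v *)
From HB Require Import structures.
From mathcomp Require Import all_boot all_order all_algebra finmap.
From mathcomp Require Import all_classical all_reals.
From mathcomp Require Import topology normedtype sequences numfun.

Set Implicit Arguments.
Unset Strict Implicit.
Unset Printing Implicit Defensive.
Import Order.TTheory GRing.Theory Num.Theory.
Import numFieldNormedType.Exports.
Local Open Scope classical_set_scope.
Local Open Scope ring_scope.

(** Kleene's partial recursive functions: [mu_rec n] is the syntax of programs
    with [n] arguments. *)
Inductive mu_rec : nat -> Type :=
| MZero n : mu_rec n
| MSucc : mu_rec 1
| MProj n (i : 'I_n) : mu_rec n
| MComp m n (f : mu_rec m) (g : 'I_m -> mu_rec n) : mu_rec n
| MPrec n (f : mu_rec n) (g : mu_rec n.+2) : mu_rec n.+1
| MMin n (f : mu_rec n.+1) : mu_rec n.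

(** [mu_eval c v y]: the program [c] halts on the arguments [v] with value [y].
    Primitive recursion is on the first argument, and its step function gets
    the current index, the previous value and the parameters, in this order;
    [h] is the sequence of the intermediate values.  Minimization is partial:
    [f] has to halt with a nonzero value below the zero that is returned. *)
Fixpoint mu_eval n (c : mu_rec n) : n.-tuple nat -> nat -> Prop :=
  match c in mu_rec n return n.-tuple nat -> nat -> Prop with
  | MZero _ => fun _ y => y = 0%N
  | MSucc => fun v y => y = (thead v).+1
  | MProj _ i => fun v y => y = tnth v i
  | MComp m _ f g => fun v y => exists w : m.-tuple nat,
      (forall i, mu_eval (g i) v (tnth w i)) /\ mu_eval f w y
  | MPrec _ f g => fun v y => exists h : nat -> nat,
      [/\ mu_eval f (behead_tuple v) (h 0%N),
          (forall k, (k < thead v)%N ->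
             mu_eval g [tuple of k :: h k :: behead_tuple v] (h k.+1)) &
          y = h (thead v)]
  | MMin _ f => fun v y =>
      mu_eval f [tuple of y :: v] 0%N /\
      (forall z, (z < y)%N -> exists u, mu_eval f [tuple of z :: v] u.+1)
  end.

Definition computable (f : nat -> nat) : Prop :=
  exists c : mu_rec 1, forall n, mu_eval c [tuple n] (f n).

Definition computable_rat (q : nat -> rat) : Prop :=
  exists s a b : nat -> nat,
    [/\ computable s, computable a, computable b,
        (forall n, b n != 0%N) &
        forall n, q n = (-1) ^+ s n * (a n)%:R / (b n)%:R].

(** [bin_value R D] is the real number written $2^{-D}$. *)
Definition bin_value (R : realType) (D : set nat) : R :=
  limn (series (fun a : nat => \1_D a * 2 ^- a.+1 : R)).

Definition left_computable (R : realType) (x : R) : Prop :=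
  exists q : nat -> rat,
    [/\ computable_rat q, nondecreasing_seq q &
        (ratr (q n) : R) @[n --> \oo] --> x].

Definition regainingly_approximable (R : realType) (x : R) : Prop :=
  exists q : nat -> rat,
    [/\ computable_rat q, nondecreasing_seq q,
        (ratr (q n) : R) @[n --> \oo] --> x &
        infinite_set [set n : nat | x - ratr (q n) < 2 ^- n]].

Definition strong_array (B : nat -> {fset nat}) : Prop :=
  computable (fun n => (\sum_(i <- B n) 2 ^ i)%N).

(** The last condition is convergence of characteristic functions in the
    discrete space [bool]. *)
Definition left_approximation (R : realType) (A : set nat)
    (B : nat -> {fset nat}) : Prop :=
  [/\ strong_array B,
      (forall n, [set` B n] `<=` `I_n),
      (forall n, bin_value R [set` B n] <= bin_value R [set` B n.+1]) &
      forall i, ((i \in B n) : bool) @[n --> \oo] --> ((i \in A) : bool)].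

(* Main.v *)
Require Import Defs.
From mathcomp Require Import all_boot all_order all_algebra finmap.
From mathcomp Require Import all_classical all_reals interval_inference.
From mathcomp Require Import topology normedtype sequences numfun.
From mathcomp Require Import zify ring lra.

(** Write [T n] for the integer whose binary digits are the first [n] digits of
    [A], and similarly for other sets.  Along a left approximation [B] of [A],
    the truncations [T_B(m) n] increase with [m] and stabilize at [T n], so
    comparing [A] with a stage of [B] up to [n] amounts to comparing integers.

    (1) => (2): if [q] increases to [2^{-A}], then [d n = floor (2 ^ n q n)] is
    at most [T n], and at least [T n - 1] whenever [2^{-A} - q n < 2 ^ -n].  So
    infinitely often [d n = T n], or else eventually [d n + 1 <= T n] with
    infinitely many equalities; either way one gets computable lower bounds of
    [T n] that are infinitely often exact, and their running maxima are the
    digits of a left approximation.  This uses that [2^{-A}] is not dyadic; if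
    [A] is finite or cofinite, then [T] itself is computable.

    (2) => (3): wait until the first [n] digits of [B] have reached those of the
    [n]-th stage of the approximation given by (2).

    (3) => (1): some left approximation [B] exists by the construction above,
    and [2^{-B (s n.+1)}] is within [2 ^ -n.+1] of [2^{-A}] infinitely often;
    the shift by one makes the required inequality strict. *)

Local Open Scope classical_set_scope.

Set Implicit Arguments.
Unset Strict Implicit.
Unset Printing Implicit Defensive.
Import Order.TTheory GRing.Theory Num.Theory.
Import numFieldNormedType.Exports.

(** * Computable functions of several arguments *)

(** Tuples of arguments are used because recursion and search carry parameters along. *)
Definition mu_computable n (F : n.-tuple nat -> nat) : Prop :=
  exists c : mu_rec n, forall v, mu_eval c v (F v).

Lemma mu_computable_comp m n (F : m.-tuple nat -> nat)
    (G : 'I_m -> n.-tuple nat -> nat) :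
  mu_computable F -> (forall i, mu_computable (G i)) ->
  mu_computable (fun v => F [tuple G i v | i < m]).
Proof.
move=> [c Hc] /choice[g Hg]; exists (MComp c g) => v.
by exists [tuple G i v | i < m]; split => // i; rewrite tnth_mktuple; apply: Hg.
Qed.

Lemma mu_computable_proj n (i : 'I_n) : mu_computable (fun v => tnth v i).
Proof. by exists (MProj i). Qed.

Lemma mu_computable_head n :
  mu_computable (fun v : n.+1.-tuple nat => thead v).
Proof. exact: mu_computable_proj. Qed.

Lemma mu_computable_behead n (F : n.-tuple nat -> nat) :
  mu_computable F ->
  mu_computable (fun v : n.+1.-tuple nat => F (behead_tuple v)).
Proof.
move=> HF; have := mu_computable_comp HF (fun i => mu_computable_proj (lift ord0 i)).
congr mu_computable; apply/funext => v; congr F.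
by apply: eq_from_tnth => i; rewrite tnth_mktuple tnth_behead; congr tnth; apply/val_inj; rewrite /= inordK ?ltnS.
Qed.

(** Composition with [G] and all projections; it lets a recursion run up to a computed bound. *)
Lemma mu_computable_cons n (F : n.+1.-tuple nat -> nat) (G : n.-tuple nat -> nat) :
  mu_computable F -> mu_computable G ->
  mu_computable (fun v => F [tuple of G v :: v]).
Proof.
move=> HF HG.
have H i : mu_computable (fun v : n.-tuple nat => tnth [tuple of G v :: v] i).
  case: (unliftP ord0 i) => [j|] ->; last by congr mu_computable: HG.
  have := mu_computable_proj j; congr mu_computable; apply/funext => v.
  by rewrite !(tnth_nth 0).
have := mu_computable_comp HF H; congr mu_computable; apply/funext => v; congr F.
by apply: eq_from_tnth => i; rewrite tnth_mktuple.
Qed.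

Lemma mu_computableP (f : nat -> nat) :
  computable f <-> mu_computable (fun v : 1.-tuple nat => f (thead v)).
Proof.
split=> -[c Hc]; exists c => v; last by have := Hc [tuple v]; rewrite theadE.
by have := Hc (thead v); congr mu_eval; apply/val_inj; case: v => -[|x [|]].
Qed.

Lemma mu_computable_unary n (f : nat -> nat) (G : n.-tuple nat -> nat) :
  computable f -> mu_computable G -> mu_computable (fun v => f (G v)).
Proof.
move=> /mu_computableP Hf HG; have := mu_computable_comp Hf (fun=> HG).
by congr mu_computable; apply/funext => v; rewrite /thead tnth_mktuple.
Qed.

Lemma mu_computable_succ n (G : n.-tuple nat -> nat) :
  mu_computable G -> mu_computable (fun v => (G v).+1).
Proof. by apply: mu_computable_unary; exists MSucc. Qed.

Lemma mu_computable_cst n (k : nat) : mu_computable (fun _ : n.-tuple nat => k).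
Proof.
elim: k => [|k IH]; first by exists (MZero n).
exact: mu_computable_succ.
Qed.

Lemma behead_cons n (x : nat) (v : n.-tuple nat) :
  behead_tuple [tuple of x :: v] = v.
Proof. exact/val_inj. Qed.

Lemma mu_computable_rec n (Z N : n.-tuple nat -> nat)
    (S : nat -> nat -> n.-tuple nat -> nat) :
  mu_computable Z -> mu_computable N ->
  mu_computable (fun v : n.+2.-tuple nat =>
    S (thead v) (thead (behead_tuple v)) (behead_tuple (behead_tuple v))) ->
  mu_computable (fun v => nat_rec (fun=> nat) (Z v) (fun k r => S k r v) (N v)).
Proof.
move=> [z Hz] HN [s Hs].
have H : mu_computable (fun v : n.+1.-tuple nat =>
  nat_rec (fun=> nat) (Z (behead_tuple v)) (fun k r => S k r (behead_tuple v)) (thead v)).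
  exists (MPrec z s) => v /=.
  pose r := nat_rec (fun=> nat) (Z (behead_tuple v))
              (fun k r => S k r (behead_tuple v)).
  exists r; split => // k _.
  have := Hs [tuple of k :: r k :: behead_tuple v].
  by rewrite theadE [behead_tuple [tuple of k :: _]]behead_cons theadE behead_cons.
have := mu_computable_cons H HN; congr mu_computable; apply/funext => v.
by rewrite theadE behead_cons.
Qed.

(** As [F] is total and [m v] is its least zero, every smaller candidate halts with a nonzero value,
    as [MMin] demands. *)
Lemma mu_computable_min n (F : nat -> n.-tuple nat -> nat) (m : n.-tuple nat -> nat) :
  mu_computable (fun v : n.+1.-tuple nat => F (thead v) (behead_tuple v)) ->
  (forall v, F (m v) v = 0) -> (forall v z, z < m v -> F z v <> 0) ->
  mu_computable m.
Proof.
move=> [c Hc] F0 F1; exists (MMin c) => v /=.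
have E y : mu_eval c [tuple of y :: v] (F y v).
  by have := Hc [tuple of y :: v]; rewrite theadE behead_cons.
split=> [|z zy]; first by rewrite -(F0 v).
by exists (F z v).-1; rewrite prednK // lt0n; apply/eqP; exact: F1.
Qed.

Lemma mu_computable_eq n (F G : n.-tuple nat -> nat) :
  F =1 G -> mu_computable F -> mu_computable G.
Proof. by move=> /funext ->. Qed.

Lemma mu_computable_add n (G H : n.-tuple nat -> nat) :
  mu_computable G -> mu_computable H -> mu_computable (fun v => G v + H v).
Proof.
move=> HG HH.
apply: (@mu_computable_eq _ (fun v => nat_rec (fun=> nat) (H v) (fun _ r => r.+1) (G v))).
  by move=> v; elim: (G v) => //= k ->.
apply: mu_computable_rec HG _ => //.
exact: mu_computable_succ (mu_computable_behead (mu_computable_head _)).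
Qed.

Lemma mu_computable_pred n (G : n.-tuple nat -> nat) :
  mu_computable G -> mu_computable (fun v => (G v).-1).
Proof.
move=> HG.
apply: (@mu_computable_eq _ (fun v => nat_rec (fun=> nat) 0 (fun k _ => k) (G v))).
  by move=> v; case: (G v).
apply: mu_computable_rec HG _; first exact: mu_computable_cst.
exact: mu_computable_head.
Qed.

Lemma mu_computable_sub n (G H : n.-tuple nat -> nat) :
  mu_computable G -> mu_computable H -> mu_computable (fun v => G v - H v).
Proof.
move=> HG HH.
apply: (@mu_computable_eq _ (fun v => nat_rec (fun=> nat) (G v) (fun _ r => r.-1) (H v))).
  by move=> v; elim: (H v) => [|k /= ->]; rewrite ?subn0 ?subnS.
apply: mu_computable_rec HH _ => //.
exact: mu_computable_pred (mu_computable_behead (mu_computable_head _)).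
Qed.

Lemma mu_computable_mul n (G H : n.-tuple nat -> nat) :
  mu_computable G -> mu_computable H -> mu_computable (fun v => G v * H v).
Proof.
move=> HG HH.
apply: (@mu_computable_eq _ (fun v => nat_rec (fun=> nat) 0 (fun _ r => H v + r) (G v))).
  by move=> v; elim: (G v) => //= k ->; rewrite mulSn.
apply: mu_computable_rec HG _; first exact: mu_computable_cst.
apply: mu_computable_add.
  exact: (mu_computable_behead (mu_computable_behead HH)).
exact: (mu_computable_behead (mu_computable_head _)).
Qed.

Lemma mu_computable_exp n (G H : n.-tuple nat -> nat) :
  mu_computable G -> mu_computable H -> mu_computable (fun v => G v ^ H v).
Proof.
move=> HG HH.
apply: (@mu_computable_eq _ (fun v => nat_rec (fun=> nat) 1 (fun _ r => G v * r) (H v))).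
  by move=> v; elim: (H v) => //= k ->; rewrite expnS.
apply: mu_computable_rec HH _; first exact: mu_computable_cst.
apply: mu_computable_mul.
  exact: (mu_computable_behead (mu_computable_behead HG)).
exact: (mu_computable_behead (mu_computable_head _)).
Qed.

Lemma mu_computable_leq n (G H : n.-tuple nat -> nat) :
  mu_computable G -> mu_computable H ->
  mu_computable (fun v => nat_of_bool (G v <= H v)).
Proof.
move=> HG HH; apply: (@mu_computable_eq _ (fun v => 1 - (G v - H v))).
  by move=> v; rewrite /leq; case: (G v - H v).
exact: mu_computable_sub (mu_computable_cst _ _) (mu_computable_sub HG HH).
Qed.

Lemma mu_computable_odd n (G : n.-tuple nat -> nat) :
  mu_computable G -> mu_computable (fun v => nat_of_bool (odd (G v))).
Proof.
move=> HG.
apply: (@mu_computable_eq _ (fun v => nat_rec (fun=> nat) 0 (fun _ r => 1 - r) (G v))).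
  by move=> v; elim: (G v) => //= k ->; case: odd.
apply: mu_computable_rec HG _; first exact: mu_computable_cst.
apply: mu_computable_sub; first exact: mu_computable_cst.
exact: (mu_computable_behead (mu_computable_head _)).
Qed.

(** Recursion on the numerator: from [k] to [k.+1] the quotient [r] grows by one exactly when the
    next multiple [r.+1 * H v] is reached. *)
Lemma mu_computable_div n (G H : n.-tuple nat -> nat) :
  mu_computable G -> mu_computable H -> (forall v, H v != 0) ->
  mu_computable (fun v => G v %/ H v).
Proof.
move=> HG HH H0.
apply: (@mu_computable_eq _ (fun v =>
  nat_rec (fun=> nat) 0 (fun k r => r + (r.+1 * H v <= k.+1)) (G v))).
  move=> v; elim: (G v) => [|k /= ->]; first by rewrite div0n.
  have Hv : 0 < H v by rewrite lt0n.
  rewrite -leq_divRL // divnS // addnC; congr (_ + _).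
  by case: dvdnP => //= _; rewrite ?ltnn // ltnS leqnn.
apply: mu_computable_rec HG _; first exact: mu_computable_cst.
have Hr m := mu_computable_behead (mu_computable_head m).
apply: mu_computable_add; first exact: Hr.
apply: mu_computable_leq; last exact/mu_computable_succ/mu_computable_head.
apply: mu_computable_mul; first exact: mu_computable_succ (Hr _).
exact: (mu_computable_behead (mu_computable_behead HH)).
Qed.

Lemma mu_computable_max n (G H : n.-tuple nat -> nat) :
  mu_computable G -> mu_computable H -> mu_computable (fun v => maxn (G v) (H v)).
Proof.
move=> HG HH; apply: (@mu_computable_eq _ (fun v => G v + (H v - G v))).
  by move=> v; rewrite maxnE.
exact: mu_computable_add HG (mu_computable_sub HH HG).
Qed.

(** * Truncated binary expansions *)

(* [trunc b n] is the integer with binary digits [b 0], ..., [b (n-1)], most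
   significant first; for the characteristic function of [A] it is
   [2 ^ n * 2^{-(A `&` `I_n)}]. *)
Fixpoint trunc (b : nat -> bool) (n : nat) : nat :=
  if n is n'.+1 then (trunc b n').*2 + b n' else 0.

Lemma trunc_lt b n : trunc b n < 2 ^ n.
Proof. by elim: n => //= n IH; rewrite expnS; case: (b n); lia. Qed.

Lemma eq_trunc b b' n :
  (forall i, i < n -> b i = b' i) -> trunc b n = trunc b' n.
Proof.
elim: n => //= n IH H; rewrite H // IH // => i ilt.
by apply: H; rewrite ltnS ltnW.
Qed.

Lemma trunc_inj b b' n :
  trunc b n = trunc b' n -> forall i, i < n -> b i = b' i.
Proof.
elim: n => //= n IH H i.
have [E1 E2] : trunc b n = trunc b' n /\ b n = b' n.
  by move: H; case: (b n); case: (b' n); lia.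
by rewrite ltnS leq_eqVlt => /orP[/eqP->//|]; apply: IH.
Qed.

Lemma trunc_div b n m : trunc b (n + m) %/ 2 ^ m = trunc b n.
Proof.
elim: m => [|m IH]; first by rewrite addn0 divn1.
rewrite addnS expnS divnMA /= -muln2 divnMDl //.
by rewrite (_ : nat_of_bool _ %/ 2 = 0) ?addn0 ?IH //; case: (b _).
Qed.

Lemma trunc_shift b n m : trunc b n * 2 ^ m <= trunc b (n + m).
Proof. by rewrite -(trunc_div b n m) leq_trunc_div. Qed.

Lemma trunc_bits c n : c < 2 ^ n ->
  trunc (fun i => odd (c %/ 2 ^ (n - i.+1))) n = c.
Proof.
(* The digits depend on [n], so [n] stays fixed and the induction is on the length [k] of the
   prefix. *)
move=> cn; suff H k : k <= n ->
    trunc (fun i => odd (c %/ 2 ^ (n - i.+1))) k = c %/ 2 ^ (n - k).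
  by rewrite H // subnn divn1.
elim: k => [|k IH] kn /=; first by rewrite subn0 divn_small.
rewrite (IH (ltnW kn)) (_ : n - k = (n - k.+1) + 1); last by lia.
by rewrite expnD divnMA divn2 addnC odd_double_half.
Qed.

(** * Binary codes of finite sets *)

(** Codes have the least significant digit first, unlike [trunc]. Halving drops digit 0 and shifts
    the others, whence the induction on [i] for all [b]. *)
Lemma odd_binary_sum (b : nat -> bool) n i :
  odd ((\sum_(j < n) b j * 2 ^ j) %/ 2 ^ i) = (i < n) && b i.
Proof.
elim: i b n => [|i IH] b [|n]; rewrite ?big_ord0 ?div0n // big_ord_recl muln1.
  rewrite divn1 oddD (eq_bigr (fun j : 'I_n => 2 * (b j.+1 * 2 ^ j))); last first.
    by move=> j _; rewrite lift0 expnS mulnCA.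
  by rewrite -big_distrr /= oddM /= addbF oddb.
rewrite (eq_bigr (fun j : 'I_n => 2 * (b j.+1 * 2 ^ j))); last first.
  by move=> j _; rewrite lift0 expnS mulnCA.
rewrite -big_distrr /= expnS divnMA addnC mulnC divnMDl //.
by rewrite (divn_small (_ : b 0 < 2)) ?addn0 ?(IH (fun j => b j.+1)) //; case: (b 0).
Qed.

(** A sum weighted by the indicator over a bounded range can be computed by recursion and read bit
    by bit. *)
Lemma sum_fset_nat (D : {fset nat}) n (F : nat -> nat) :
  [set` D] `<=` `I_n ->
  \sum_(i <- D) F i = \sum_(i < n) (val i \in D) * F i.
Proof.
move=> Dn; rewrite -(big_mkord xpredT (fun i => (i \in D) * F i)).
rewrite [RHS](eq_bigr (fun i => if i \in D then F i else 0)); last first.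
  by move=> i _; case: (i \in D); rewrite ?mul1n ?mul0n.
rewrite -big_mkcond -[RHS]big_filter; apply: perm_big; apply: uniq_perm.
- exact: fset_uniq.
- exact/filter_uniq/iota_uniq.
- move=> i; rewrite mem_filter mem_index_iota /=.
  by case: (boolP (i \in D)) => //= /Dn /= ->.
Qed.

Lemma bit_fset_code (D : {fset nat}) n i : [set` D] `<=` `I_n ->
  odd ((\sum_(j <- D) 2 ^ j) %/ 2 ^ i) = (i \in D).
Proof.
move=> Dn; rewrite (sum_fset_nat _ Dn) (odd_binary_sum (fun i => i \in D)).
by case: (boolP (i \in D)) => [/Dn /= ->//|]; rewrite andbF.
Qed.

(** When [C v] codes a finite set, this is the truncation of that set: bit [i] of the code is its
    digit [i]. *)
Lemma mu_computable_trunc n (C N : n.-tuple nat -> nat) :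
  mu_computable C -> mu_computable N ->
  mu_computable (fun v => trunc (fun i => odd (C v %/ 2 ^ i)) (N v)).
Proof.
move=> HC HN.
apply: (@mu_computable_eq _ (fun v => nat_rec (fun=> nat) 0
  (fun k r => (r + r) + odd (C v %/ 2 ^ k)) (N v))).
  by move=> v; elim: (N v) => //= k ->; rewrite addnn.
apply: mu_computable_rec HN _; first exact: mu_computable_cst.
have Hr m := mu_computable_behead (mu_computable_head m).
apply: mu_computable_add; first exact: mu_computable_add (Hr _) (Hr _).
apply: mu_computable_odd; apply: mu_computable_div.
- exact: (mu_computable_behead (mu_computable_behead HC)).
- exact: mu_computable_exp (mu_computable_cst _ _) (mu_computable_head _).
- by move=> v; rewrite -lt0n expn_gt0.
Qed.

Lemma mu_computable_sum n (N : n.-tuple nat -> nat)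
    (F : nat -> n.-tuple nat -> nat) :
  mu_computable N ->
  mu_computable (fun v : n.+1.-tuple nat => F (thead v) (behead_tuple v)) ->
  mu_computable (fun v => \sum_(i < N v) F i v).
Proof.
move=> HN HF.
apply: (@mu_computable_eq _ (fun v => nat_rec (fun=> nat) 0
  (fun k r => r + F k v) (N v))).
  move=> v; elim: (N v) => [|k /= ->]; first by rewrite big_ord0.
  by rewrite big_ord_recr.
apply: mu_computable_rec HN _; first exact: mu_computable_cst.
apply: mu_computable_add.
  exact: mu_computable_behead (mu_computable_head _).
(* [G] selects the index and the parameters among the arguments of the recursion step, skipping the
   accumulated sum. *)
pose G (i : 'I_n.+1) : n.+2.-tuple nat -> nat := 
  if unlift ord0 i is Some j then fun v => tnth (behead_tuple (behead_tuple v)) j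
  else fun v => thead v.
have HG i : mu_computable (G i).
  rewrite /G; case: unlift => [j|]; last exact: mu_computable_head.
  exact: mu_computable_behead (mu_computable_behead (mu_computable_proj j)).
have := mu_computable_comp HF HG; congr mu_computable; apply/funext => v.
congr F; first by rewrite /thead tnth_mktuple /G unlift_none.
apply: eq_from_tnth => j; rewrite tnth_behead tnth_mktuple /G.
have -> : inord j.+1 = lift ord0 j by apply/val_inj; rewrite /= inordK // ltnS.
by rewrite liftK.
Qed.

Lemma infinite_natP (S : set nat) :
  infinite_set S <-> forall n, exists2 i, n <= i & S i.
Proof.
split=> [Sinf n|H /finite_fsetP[X SX]].
  apply: contrapT => H; apply: Sinf; apply: sub_finite_set (finite_II n) => i Si /=.
  by rewrite ltnNge; apply/negP => ni; apply: H; exists i.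
have [i Xi] := H (\max_(j <- X) j).+1.
by rewrite SX /= => iX; have := @leq_bigmax_seq _ (enum_fset X) xpredT id i iX isT; rewrite leqNgt Xi.
Qed.

(** * Dyadic intervals around the value of a set *)

Section BinaryValue.
Variable R : realType.
Local Open Scope ring_scope.

Lemma series_trunc (D : set nat) n :
  series (fun a : nat => \1_D a * 2 ^- a.+1 : R) n =
  (trunc (fun i => i \in D) n)%:R / 2 ^+ n.
Proof.
elim: n => [|n IH]; first by rewrite /series /= big_geq // mul0r.
rewrite seriesSr IH /= indicE natrD -addnn natrD exprS.
by field; rewrite expf_neq0 ?pnatr_eq0.
Qed.

Lemma trunc_nondecreasing (b : nat -> bool) :
  nondecreasing_seq (fun n => (trunc b n)%:R / 2 ^+ n : R).
Proof.
apply/nondecreasing_seqP => n /=.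
rewrite ler_pdivrMr ?exprn_gt0 // mulrAC ler_pdivlMr ?exprn_gt0 //.
rewrite -!natrX -!natrM ler_nat expnS; case: (b n); nia.
Qed.

Lemma truncS_nonincreasing (b : nat -> bool) :
  nonincreasing_seq (fun n => (trunc b n).+1%:R / 2 ^+ n : R).
Proof.
apply/nonincreasing_seqP => n /=.
rewrite ler_pdivrMr ?exprn_gt0 // mulrAC ler_pdivlMr ?exprn_gt0 //.
rewrite -!natrX -!natrM ler_nat expnS; case: (b n); nia.
Qed.

(** The dyadic intervals from [trunc b n / 2 ^ n] to [(trunc b n).+1 / 2 ^ n] are nested, so both
    endpoints can be compared at the larger index. *)
Lemma trunc_ltS (b : nat -> bool) m n :
  (trunc b m)%:R / 2 ^+ m < (trunc b n).+1%:R / 2 ^+ n :> R.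
Proof.
have [mn|/ltnW nm] := leqP m n.
  apply: le_lt_trans (trunc_nondecreasing b mn) _ => /=.
  by rewrite ltr_pM2r ?invr_gt0 ?exprn_gt0 // ltr_nat.
apply: lt_le_trans (truncS_nonincreasing b nm) => /=.
by rewrite ltr_pM2r ?invr_gt0 ?exprn_gt0 // ltr_nat.
Qed.

Lemma bin_valueE (D : set nat) :
  (trunc (fun i => i \in D) n)%:R / 2 ^+ n @[n --> \oo] --> bin_value R D.
Proof.
rewrite /bin_value (_ : series _ = fun n => (trunc (fun i => i \in D) n)%:R / 2 ^+ n); last first.
  by apply/funext => n; rewrite series_trunc.
apply: nondecreasing_is_cvgn; first exact: trunc_nondecreasing.
exists 1 => _ [n _ <-]; apply/ltW; have := trunc_ltS (fun i => i \in D) n 0.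
by rewrite /= expr0 divr1.
Qed.

Lemma trunc_le_bin_value (D : set nat) n :
  (trunc (fun i => i \in D) n)%:R / 2 ^+ n <= bin_value R D.
Proof.
rewrite -(cvg_lim (@order_hausdorff _ R) (bin_valueE (D := D))).
apply: (nondecreasing_cvgn_le (trunc_nondecreasing (fun i => i \in D))).
by apply/cvg_ex; exists (bin_value R D); exact: bin_valueE.
Qed.

Lemma bin_value_le_truncS (D : set nat) n :
  bin_value R D <= (trunc (fun i => i \in D) n).+1%:R / 2 ^+ n.
Proof.
rewrite -(cvg_lim (@order_hausdorff _ R) (bin_valueE (D := D))).
apply: limr_le; first by apply/cvg_ex; exists (bin_value R D); exact: bin_valueE.
by apply: nearW => m; exact/ltW/trunc_ltS.
Qed.

Lemma bin_value_bounded (D : set nat) n : D `<=` `I_n ->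
  bin_value R D = (trunc (fun i => i \in D) n)%:R / 2 ^+ n.
Proof.
move=> Dn; have := bin_valueE (D := D); rewrite -(cvg_shiftn n) => H.
rewrite -(cvg_lim (@order_hausdorff _ R) H).
apply: (lim_near_cst (@order_hausdorff _ R)); apply: nearW => m.
elim: m => // m IH; rewrite -[RHS]IH /=.
rewrite (_ : (m + n)%N \in D = false); last first.
  by apply/negbTE/negP => /set_mem /Dn /=; lia.
rewrite addn0 -muln2 natrM exprS.
by field; rewrite expf_neq0 ?pnatr_eq0.
Qed.

(** A digit 1 at some [i >= n] moves the left endpoint strictly up. *)
Lemma trunc_lt_bin_value (A : set nat) n : infinite_set A ->
  (trunc (fun i => i \in A) n)%:R / 2 ^+ n < bin_value R A.
Proof.
move=> /infinite_natP/(_ n)[i ni Ai].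
apply: lt_le_trans (trunc_le_bin_value A i.+1).
apply: le_lt_trans (trunc_nondecreasing _ ni) _ => /=.
rewrite mem_set // exprS invfM mulrA ltr_pM2r ?invr_gt0 ?exprn_gt0 //.
rewrite ltr_pdivlMr // -natrM ltr_nat; lia.
Qed.

(** A digit 0 at some [i >= n] moves the right endpoint strictly down. *)
Lemma bin_value_lt_truncS (A : set nat) n : infinite_set (~` A) ->
  bin_value R A < (trunc (fun i => i \in A) n).+1%:R / 2 ^+ n.
Proof.
move=> /infinite_natP/(_ n)[i ni Ai].
apply: le_lt_trans (bin_value_le_truncS A i.+1) _.
apply: lt_le_trans (truncS_nonincreasing _ ni) => /=.
rewrite memNset // exprS invfM mulrA ltr_pM2r ?invr_gt0 ?exprn_gt0 //.
rewrite ltr_pdivrMr // -natrM ltr_nat; lia.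
Qed.

End BinaryValue.

(** * Truncations along a left approximation *)

Section LeftApproximation.
Variables (R : realType) (A : set nat) (B : nat -> {fset nat}).
Hypothesis hB : left_approximation R A B.

Lemma left_approximation_stable n :
  exists M, forall m, M <= m ->
    trunc (fun i => i \in B m) n = trunc (fun i => i \in A) n.
Proof.
case: hB => _ _ _ H; elim: n => [|n [M HM]]; first by exists 0.
(* The space [bool] is discrete, so convergence means eventual equality. *)
have [N _ HN] : \forall m \near \oo, (n \in B m) = (n \in A).
  by apply: (H n [set n \in A]); rewrite nbhs_principalE.
exists (maxn M N) => m; rewrite geq_max => /andP[/HM /= -> /HN /= ->] //.
Qed.

(** Both stages fit into [K] digits, so their values compare as [K]-digit integers; dividing by
    [2 ^ (K - n)] keeps the order. *)
Lemma left_approximation_trunc_homo n m m' : m <= m' ->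
  trunc (fun i => i \in B m) n <= trunc (fun i => i \in B m') n.
Proof.
case: hB => _ HI Hle _ mm'.
have := (nondecreasing_seqP (fun m => bin_value R [set` B m])).1 Hle m m' mm'.
set K := maxn n m'.
have HK k : k <= m' -> [set` B k] `<=` `I_K.
  by move=> km i /HI /= ik; rewrite /K; lia.
rewrite !(@bin_value_bounded R _ K) //; try exact: HK.
rewrite ler_pM2r ?invr_gt0 ?exprn_gt0 // ler_nat.
under [X in X <= _]eq_trunc => i _ do rewrite mem_setE.
under [X in _ <= X]eq_trunc => i _ do rewrite mem_setE.
have -> : K = n + (K - n) by rewrite /K; lia.
by move=> /(leq_div2r (2 ^ (K - n))); rewrite !trunc_div.
Qed.

Lemma left_approximation_trunc_le n m :
  trunc (fun i => i \in B m) n <= trunc (fun i => i \in A) n.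
Proof.
have [M HM] := left_approximation_stable n.
by rewrite -(HM (maxn M m)) ?leq_maxl //; exact/left_approximation_trunc_homo/leq_maxr.
Qed.

End LeftApproximation.

(** * Construction of left approximations *)

Lemma trunc_eqP (A : set nat) (D : {fset nat}) n :
  trunc (fun i => i \in A) n = trunc (fun i => i \in D) n <->
  A `&` `I_n = [set` D] `&` `I_n.
Proof.
split=> [/trunc_inj H|H].
  apply/seteqP; split=> i [/= Hi ilt]; split=> //.
    by rewrite -H // mem_set.
  by apply: set_mem; rewrite H.
apply: eq_trunc => i ilt; apply/idP/idP => [/set_mem Ai|Di].
  by have : (A `&` `I_n) i by []; rewrite H => -[].
have : ([set` D] `&` `I_n) i by [].
by rewrite -H => -[Ai _]; exact: mem_set.
Qed.

(* The stages [c n = max_{m <= n} d m * 2 ^ (n - m)] satisfy [2 c n <= c n.+1],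
   so that the sets with digits [c n] increase lexicographically. *)
Lemma left_approximation_of_lower_bounds (R : realType) (A : set nat)
    (d : nat -> nat) :
  computable d ->
  (forall n, d n <= trunc (fun i => i \in A) n) ->
  (forall k, exists2 n, k <= n & trunc (fun i => i \in A) k * 2 ^ (n - k) <= d n) ->
  exists B : nat -> {fset nat}, left_approximation R A B /\
    forall n, d n = trunc (fun i => i \in A) n -> A `&` `I_n = [set` B n].
Proof.
move=> dcomp dle dge.
pose c := nat_rec (fun=> nat) (d 0) (fun k r => maxn (2 * r) (d k.+1)).
(* One more digit at least doubles the truncation, so a lower bound may be doubled as well. *)
have cle n : c n <= trunc (fun i => i \in A) n.
  elim: n => [|n IH]; first exact: dle.
  by rewrite /= geq_max dle andbT -addnn; move: IH; lia.
have dc n : d n <= c n by case: n => [|n] //=; rewrite leq_maxr.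
have cS n : 2 * c n <= c n.+1 by rewrite /= leq_maxl.
have cD n m : c n * 2 ^ m <= c (n + m).
  elim: m => [|m IH]; first by rewrite muln1 addn0.
  by rewrite addnS expnS; have := cS (n + m); lia.
(* The exponent [n - i.+1] reads [c n] as an [n]-digit number, most significant digit first. *)
pose B n := [fset i in iota 0 n | odd (c n %/ 2 ^ (n - i.+1))]%fset.
have BE n i : (i \in B n) = (i < n) && odd (c n %/ 2 ^ (n - i.+1)).
  by rewrite !inE /= mem_iota add0n.
have BI n : [set` B n] `<=` `I_n by move=> i /=; rewrite BE => /andP[].
have BT n : trunc (fun i => i \in B n) n = c n.
  rewrite -[RHS](@trunc_bits _ n); last exact: leq_ltn_trans (cle n) (trunc_lt _ _).
  by apply: eq_trunc => i ilt; rewrite BE ilt.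
have ccomp : mu_computable (fun v : 1.-tuple nat => c (thead v)).
  have := @mu_computable_rec 1 (fun=> d 0) (fun v => thead v)
    (fun k r _ => maxn (2 * r) (d k.+1)).
  apply; [exact: mu_computable_cst|exact: mu_computable_head|].
  apply: mu_computable_max.
    apply: mu_computable_mul; first exact: mu_computable_cst.
    exact: mu_computable_behead (mu_computable_head _).
  exact: mu_computable_unary dcomp (mu_computable_succ (mu_computable_head _)).
exists B; split; last first.
  (* [c n] lies between [d n] and the truncation of [A]. *)
  move=> n dn; have /trunc_eqP -> : trunc (fun i => i \in A) n = trunc (fun i => i \in B n) n.
    by apply/eqP; rewrite BT eqn_leq cle -dn dc.
  by apply: setIidl; exact: BI.
split=> //.
- apply/mu_computableP.
  apply: (@mu_computable_eq _ (fun v => \sum_(i < thead v)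
      odd (c (thead v) %/ 2 ^ (thead v - i.+1)) * 2 ^ i)).
    move=> v; rewrite (sum_fset_nat _ (BI (thead v))).
    by apply: eq_bigr => i _; rewrite BE ltn_ord.
  apply: (mu_computable_sum (F := fun i v => odd (c (thead v) %/ 2 ^ (thead v - i.+1)) * 2 ^ i)).
    exact: mu_computable_head.
  have H2 m G : mu_computable G -> mu_computable (fun v : m.-tuple nat => 2 ^ G v).
    by move=> HG; apply: mu_computable_exp HG; exact: mu_computable_cst.
  have Hn : mu_computable (fun v : 2.-tuple nat => thead (behead_tuple v)).
    exact: (mu_computable_behead (mu_computable_head 0)).
  apply: mu_computable_mul; last exact/H2/mu_computable_head.
  apply: mu_computable_odd; apply: mu_computable_div.
  + exact: (mu_computable_behead ccomp).
  + exact/H2/(mu_computable_sub Hn)/mu_computable_succ/mu_computable_head.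
  + by move=> v; rewrite -lt0n expn_gt0.
- move=> n; rewrite !(bin_value_bounded R (BI _)).
  have E k : trunc (fun i => i \in [set` B k]) k = c k.
    by rewrite -[RHS]BT; apply: eq_trunc => i _; rewrite mem_setE.
  rewrite !E ler_pdivrMr ?exprn_gt0 // mulrAC ler_pdivlMr ?exprn_gt0 //.
  by rewrite -!natrX -!natrM ler_nat expnS mulnA (mulnC (c n)) leq_mul2r cS orbT.
(* At stage [n0] the lower bound reaches the first [i.+1] digits of [A]. Doubling preserves this at
   later stages and [cle] forbids overshooting, so these digits are then correct. *)
- move=> i; apply: cvg_near_cst; have [n0 kn0 Hn0] := dge i.+1.
  exists n0 => // n /= n0n; rewrite BE.
  have iltn : i < n by lia.
  set k := i.+1 in kn0 Hn0 *.
  have E : c n %/ 2 ^ (n - k) = trunc (fun i => i \in A) k.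
    apply/eqP; rewrite eqn_leq; apply/andP; split.
      have := leq_div2r (2 ^ (n - k)) (cle n).
      by rewrite -[X in trunc _ X](subnKC iltn) trunc_div.
    rewrite leq_divRL ?expn_gt0 //.
    have -> : n - k = (n0 - k) + (n - n0) by lia.
    rewrite expnD mulnA.
    apply: leq_trans (_ : c n0 * 2 ^ (n - n0) <= _).
      by rewrite leq_mul2r (leq_trans Hn0 (dc n0)) orbT.
    by have := cD n0 (n - n0); rewrite subnKC.
  by rewrite iltn E /= oddD odd_double /= oddb.
Qed.

Lemma computable_trunc_eventually_constant (A : set nat) N (e : bool) :
  (forall i, N <= i -> (i \in A) = e) ->
  exists d, [/\ computable d, forall n, d n <= trunc (fun i => i \in A) n &
    forall n, N <= n -> d n = trunc (fun i => i \in A) n].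
Proof.
move=> HA; pose t := trunc (fun i => i \in A) N.
(* Appending [m] digits [e] to [t] gives [(t + e) * 2 ^ m - e]; below [N] the value 0 is a safe
   lower bound. *)
exists (fun n => (N <= n) * ((t + e) * 2 ^ (n - N) - e)).
have E n : N <= n -> (t + e) * 2 ^ (n - N) - e = trunc (fun i => i \in A) n.
  move=> /subnKC => <-; rewrite addKn.
  elim: (n - N) => [|m IH]; first by rewrite addn0 muln1 addnK.
  rewrite addnS /= -IH HA ?leq_addr // expnS.
  have : 0 < 2 ^ m by rewrite expn_gt0.
  by case: (e); nia.
split=> [|n|n Nn]; last by rewrite Nn mul1n E.
  apply/mu_computableP; have Hn := mu_computable_head 0.
  have Hc k : mu_computable (fun _ : 1.-tuple nat => k) := mu_computable_cst _ k.
  apply: mu_computable_mul; first exact: (mu_computable_leq (Hc N) Hn).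
  apply: mu_computable_sub (Hc _); apply: mu_computable_mul (Hc _) _.
  exact: mu_computable_exp (Hc 2) (mu_computable_sub Hn (Hc N)).
by case: (leqP N n) => [Nn|_]; rewrite ?mul1n ?mul0n ?E.
Qed.

Lemma left_approximation_eventually_constant (R : realType) (A : set nat) :
  finite_set A \/ finite_set (~` A) ->
  exists B : nat -> {fset nat}, left_approximation R A B /\
    infinite_set [set n : nat | A `&` `I_n = [set` B n]].
Proof.
move=> Afin.
have [N [e HA]] : exists N e, forall i, N <= i -> (i \in A) = e.
  case: Afin => [Afin|Afin].
    suff [N HN] : exists N, forall i, N <= i -> ~ A i.
      by exists N, false => i /HN Ai; rewrite memNset.
    apply: contrapT => H; move: Afin; apply/infinite_natP => N.
    apply: contrapT => HN; apply: H; exists N => i Ni Ai.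
    by apply: HN; exists i.
  suff [N HN] : exists N, forall i, N <= i -> A i.
    by exists N, true => i /HN Ai; rewrite mem_set.
  apply: contrapT => H; move: Afin; apply/infinite_natP => N.
  apply: contrapT => HN; apply: H; exists N => i Ni.
  by apply: contrapT => Ai; apply: HN; exists i.
have [d [dcomp dle dE]] := computable_trunc_eventually_constant HA.
have [|B [HB BE]] := left_approximation_of_lower_bounds R dcomp dle.
  move=> k; exists (maxn k N); first exact: leq_maxl.
  rewrite dE ?leq_maxr // -[X in _ <= trunc _ X](subnKC (leq_maxl k N)).
  exact: trunc_shift.
exists B; split=> //; apply/infinite_natP => n; exists (maxn n N) => /=.
  exact: leq_maxl.
by apply: BE; rewrite dE ?leq_maxr.
Qed.

(** * Lower bounds from rational approximations *)

Section FromRationals.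
Variables (R : realType) (A : set nat) (q : nat -> rat).
Hypotheses (qcomp : computable_rat q) (qhomo : nondecreasing_seq q).
Hypothesis qcvg : (ratr (q n) : R) @[n --> \oo] --> bin_value R A.
Hypotheses (Ainf : infinite_set A) (Ainf' : infinite_set (~` A)).
Local Open Scope ring_scope.

(** [Num.truncn] is 0 on negative rationals, so negative early terms still give lower bounds. *)
Let d n := Num.truncn (2 ^+ n * q n).

Lemma computable_truncn : computable d.
Proof.
have [s [a [b [scomp acomp bcomp b0 qE]]]] := qcomp.
apply/mu_computableP.
(* An odd [s] makes the term nonpositive, with truncation 0; the first factor encodes this. *)
apply: (@mu_computable_eq _ (fun v =>
  ((1 - odd (s (thead v))) * (2 ^ thead v * a (thead v) %/ b (thead v)))%N)).
  move=> v; set n := thead v; rewrite /d qE -signr_odd.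
  have b_gt0 : 0 < (b n)%:R :> rat by rewrite ltr0n lt0n.
  case: (odd (s n)).
    rewrite mul0n; apply/esym/truncn0Pn; rewrite -ltNge expr1 mulN1r mulNr mulrN.
    by apply: le_lt_trans ltr01; rewrite oppr_le0 mulr_ge0 ?exprn_ge0 ?divr_ge0.
  rewrite mul1n expr0 mul1r; apply/esym/truncn_def.
  rewrite mulrA ler_pdivlMr // ltr_pdivrMr // -natrX -!natrM ler_nat ltr_nat.
  by rewrite leq_trunc_div ltn_ceil // lt0n.
have Hn := mu_computable_head 0.
apply: mu_computable_mul.
  apply: mu_computable_sub; first exact: mu_computable_cst.
  exact/mu_computable_odd/(mu_computable_unary scomp).
apply: mu_computable_div; last by move=> v.
  apply: mu_computable_mul; last exact: mu_computable_unary acomp Hn.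
  exact: mu_computable_exp (mu_computable_cst _ _) Hn.
exact: mu_computable_unary bcomp Hn.
Qed.

Lemma lt_truncn_real m n : (m < d n)%N = (m.+1%:R <= 2 ^+ n * ratr (q n) :> R).
Proof.
rewrite truncn_gt_nat -(ler_rat R) ratr_nat rmorphM /= rmorphXn /= ratr_nat.
by [].
Qed.

Lemma rational_le_limit n : ratr (q n) <= bin_value R A.
Proof.
rewrite -(cvg_lim (@order_hausdorff _ R) qcvg).
apply: (@nondecreasing_cvgn_le _ (fun n => ratr (q n) : R)).
  by move=> m k mk; rewrite ler_rat; exact: qhomo.
by apply/cvg_ex; exists (bin_value R A).
Qed.

(** A larger [d n] would put [q n] at or above the right endpoint, which [2^{-A}] does not reach as
    the complement of [A] is infinite. *)
Lemma truncn_le_trunc n : (d n <= trunc (fun i => i \in A) n)%N.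
Proof.
rewrite leqNgt lt_truncn_real -ltNge mulrC -ltr_pdivlMr ?exprn_gt0 //.
apply: le_lt_trans (rational_le_limit n) _.
exact: bin_value_lt_truncS.
Qed.

(** The left endpoint at [k] is strictly below the limit, so [q] eventually stays above it; scaling
    by [2 ^ n] gives the bound. *)
Lemma truncn_ge_eventually k : exists M, forall n, (M <= n)%N -> (k <= n)%N ->
  (trunc (fun i => i \in A) k * 2 ^ (n - k) <= d n)%N.
Proof.
have [M _ HM] := cvgr_ge _ qcvg _ (trunc_lt_bin_value R k Ainf).
exists M => n /HM /= Hn kn; move: Hn.
case E: (trunc _ k * _)%N => [//|m].
rewrite lt_truncn_real -E ler_pdivrMr ?exprn_gt0 // => H.
rewrite -[n in 2 ^+ n](subnKC kn) exprD natrM natrX mulrAC.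
by rewrite ler_pM2r ?exprn_gt0 // mulrC.
Qed.

Lemma truncn_ge_frequently k : exists2 n, (k <= n)%N &
  (trunc (fun i => i \in A) k * 2 ^ (n - k) <= d n)%N.
Proof.
have [M HM] := truncn_ge_eventually k.
by exists (maxn M k); [exact: leq_maxr|apply: HM; rewrite ?leq_maxl ?leq_maxr].
Qed.

(** The left endpoint is below [2^{-A}], hence below [q n + 2 ^- n]; multiplying by [2 ^ n] leaves
    an excess of less than 1 over [2 ^ n * q n]. *)
Lemma trunc_le_truncnS n : bin_value R A - ratr (q n) < 2 ^- n ->
  (trunc (fun i => i \in A) n <= (d n).+1)%N.
Proof.
move=> H; have H1 := trunc_lt_bin_value R n Ainf.
case: (trunc _ n) H1 => [|[|m]] // H1; rewrite ltnS lt_truncn_real.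
have P : 0 < 2 ^+ n :> R by rewrite exprn_gt0.
have {}H : m.+2%:R / 2 ^+ n < 1 / 2 ^+ n + ratr (q n) :> R.
  by rewrite div1r; lra.
move: H; rewrite ltr_pdivrMr // mulrDl divfK ?gt_eqF // mulrC.
by rewrite -[m.+2%:R]natr1; lra.
Qed.

Lemma left_approximation_of_rationals :
  exists B : nat -> {fset nat}, left_approximation R A B.
Proof.
have [B [HB _]] := left_approximation_of_lower_bounds R computable_truncn
  truncn_le_trunc truncn_ge_frequently.
by exists B.
Qed.

(* At a stage [n] where [q n] is [2 ^- n]-close to the limit, [d n] is either the
   right truncation or one less.  If the first case occurs only finitely often,
   then adding 1 to [d n] never overshoots from some point on. *)
Lemma left_approximation_of_close_rationals :
  infinite_set [set n : nat | bin_value R A - ratr (q n) < 2 ^- n] ->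
  exists B : nat -> {fset nat}, left_approximation R A B /\
    infinite_set [set n : nat | A `&` `I_n = [set` B n]].
Proof.
move=> /infinite_natP close.
have [/infinite_natP dinf|] := pselect
    (infinite_set [set n | d n = trunc (fun i => i \in A) n]).
  have [B [HB BE]] := left_approximation_of_lower_bounds R computable_truncn
    truncn_le_trunc truncn_ge_frequently.
  exists B; split=> //; apply/infinite_natP => n.
  by have [i ni /BE Hi] := dinf n; exists i.
move=> dfin.
have [N HN] : exists N, forall n, (N <= n)%N -> (d n < trunc (fun i => i \in A) n)%N.
  apply: contrapT => H; apply: dfin; apply/infinite_natP => N.
  apply: contrapT => HN; apply: H; exists N => n Nn.
  rewrite ltn_neqAle truncn_le_trunc andbT; apply/eqP => E.
  by apply: HN; exists n.
(* The factor [N <= n] gives 0 at the early stages, where adding 1 might overshoot. *)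
pose d' n := ((N <= n) * (d n).+1)%N.
have d'comp : computable d'.
  apply/mu_computableP; have Hn := mu_computable_head 0.
  apply: mu_computable_mul.
    by apply: mu_computable_leq Hn; exact: mu_computable_cst.
  exact/mu_computable_succ/(mu_computable_unary computable_truncn).
have d'le n : (d' n <= trunc (fun i => i \in A) n)%N.
  by rewrite /d'; case: (leqP N n) => [/HN|]; rewrite ?mul1n ?mul0n.
have [|B [HB BE]] := left_approximation_of_lower_bounds R d'comp d'le.
  move=> k; have [M HM] := truncn_ge_eventually k.
  exists (maxn N (maxn M k)); first by lia.
  by rewrite /d' leq_maxl mul1n; apply/leqW/HM; lia.
exists B; split=> //; apply/infinite_natP => n.
(* At a close stage [i >= N] the truncation is at most [(d i).+1 = d' i], so [d' i] is exact. *)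
have [i ni Hi] := close (maxn N n); exists i => /=; first by lia.
apply: BE; apply/eqP; rewrite eqn_leq d'le /d' /=.
by rewrite (_ : (N <= i)%N) ?mul1n ?trunc_le_truncnS //; lia.
Qed.

End FromRationals.

Lemma left_computable_left_approximation (R : realType) (A : set nat) :
  left_computable (bin_value R A) ->
  exists B : nat -> {fset nat}, left_approximation R A B.
Proof.
move=> [q [qcomp qhomo qcvg]].
have [Afin|Ainf] := pselect (finite_set A).
  by have [B []] := left_approximation_eventually_constant R (or_introl Afin); exists B.
have [Afin|Ainf'] := pselect (finite_set (~` A)).
  by have [B []] := left_approximation_eventually_constant R (or_intror Afin); exists B.
exact: left_approximation_of_rationals qcomp qhomo qcvg Ainf Ainf'.
Qed.

Lemma regaining_left_approximation (R : realType) (A : set nat) :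
  regainingly_approximable (bin_value R A) ->
  exists B : nat -> {fset nat}, left_approximation R A B /\
    infinite_set [set n : nat | A `&` `I_n = [set` B n]].
Proof.
move=> [q [qcomp qhomo qcvg close]].
have [Afin|Ainf] := pselect (finite_set A).
  by apply: left_approximation_eventually_constant; left.
have [Afin|Ainf'] := pselect (finite_set (~` A)).
  by apply: left_approximation_eventually_constant; right.
exact: left_approximation_of_close_rationals qcomp qhomo qcvg Ainf Ainf' close.
Qed.

(** * Overtaking one left approximation by another *)

(** The digits of a stage are bits of its code, so truncations of stages can be compared
    effectively. *)
Lemma strong_array_trunc (B : nat -> {fset nat}) n (M K : n.-tuple nat -> nat) :
  strong_array B -> (forall m, [set` B m] `<=` `I_m) ->
  mu_computable M -> mu_computable K ->
  mu_computable (fun v => trunc (fun i => i \in B (M v)) (K v)).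
Proof.
move=> Bcomp BI HM HK.
apply: mu_computable_eq (mu_computable_trunc (mu_computable_unary Bcomp HM) HK).
by move=> v; apply: eq_trunc => i _; rewrite (bit_fset_code _ (BI _)).
Qed.

(* Since [B] only ever moves up, every stage after the one at which the first
   [n] digits of [B] overtake those of [C n] is good whenever [C n] is. *)
Lemma regaining_subsequence (R : realType) (A : set nat) (C B : nat -> {fset nat}) :
  left_approximation R A C ->
  infinite_set [set n : nat | A `&` `I_n = [set` C n]] ->
  left_approximation R A B ->
  exists s : nat -> nat, [/\ computable s, increasing_seq s &
    infinite_set [set n : nat | A `&` `I_n = [set` B (s n)] `&` `I_n]].
Proof.
move=> HC Cinf HB.
(* Any stage at which [B] has stabilized up to [n] works, since [C n] stays below [A]. *)
have overtake n : exists m,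
    trunc (fun i => i \in C n) n <= trunc (fun i => i \in B m) n.
  have [M HM] := left_approximation_stable HB n; exists M.
  by rewrite HM //; exact: (left_approximation_trunc_le HC).
pose t n := ex_minn (overtake n).
have tcomp : mu_computable (fun v : 1.-tuple nat => t (thead v)).
  case: HC HB => Ccomp CI _ _ [Bcomp BI _ _].
  (* The searched function is 1 as long as [B] has not caught up, so its first zero is [t]. *)
  apply: (mu_computable_min (F := fun m v => nat_of_bool
    (trunc (fun i => i \in B m) (thead v) < trunc (fun i => i \in C (thead v)) (thead v)))).
  - have Hn : mu_computable (fun v : 2.-tuple nat => thead (behead_tuple v)).
      exact: (mu_computable_behead (mu_computable_head 0)).
    apply: mu_computable_leq; last exact: strong_array_trunc.
    by apply/mu_computable_succ/strong_array_trunc => //; exact: mu_computable_head.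
  - by move=> v; rewrite /t; case: ex_minnP => m Hm _; rewrite ltnNge Hm.
  - move=> v z; rewrite /t; case: ex_minnP => m _ Hm zm.
    by case: ltnP => // /Hm; rewrite leqNgt zm.
(* The sum makes the stage at least [t n]; the summand [n] makes it strictly increasing. *)
exists (fun n => n + \sum_(j < n.+1) t j); split.
- apply/mu_computableP.
  apply: mu_computable_add (mu_computable_head 0) _.
  apply: (mu_computable_sum (F := fun i _ => t i)); first exact/mu_computable_succ/mu_computable_head.
  exact: (mu_computable_unary (iffRL (mu_computableP t) tcomp) (mu_computable_head _)).
- apply/increasing_seqP => n; rewrite ltEnat /= [X in _ < _ + X]big_ord_recr /=; lia.
- apply/infinite_natP => n; have [i ni Ci] := (infinite_natP _).1 Cinf n.
  exists i => //; apply/trunc_eqP/eqP.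
  rewrite eqn_leq (left_approximation_trunc_le HB) andbT.
  have /trunc_eqP -> : A `&` `I_i = [set` C i] `&` `I_i.
    by rewrite -Ci -setIA setIid.
  have : t i <= i + \sum_(j < i.+1) t j by rewrite big_ord_recr /=; lia.
  move=> /(left_approximation_trunc_homo HB i); apply: leq_trans.
  by rewrite /t; case: ex_minnP.
Qed.

(** * From subsequences back to regaining rationals *)

(** Both values lie in the same closed dyadic interval of length [2 ^- n]. *)
Lemma bin_value_close (R : realType) (A D : set nat) n :
  trunc (fun i => i \in A) n = trunc (fun i => i \in D) n ->
  (bin_value R A - bin_value R D <= 2 ^- n)%R.
Proof.
move=> E; have := bin_value_le_truncS R A n; have := trunc_le_bin_value R D n.
rewrite E -[(trunc _ n).+1%:R%R]natr1 mulrDl div1r; lra.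
Qed.

Lemma left_approximation_bin_value_le (R : realType) (A : set nat)
    (B : nat -> {fset nat}) m :
  left_approximation R A B -> (bin_value R [set` B m] <= bin_value R A)%R.
Proof.
move=> HB; have [_ BI _ _] := HB; rewrite (bin_value_bounded R (BI m)).
apply: le_trans (trunc_le_bin_value R A m).
rewrite ler_pM2r ?invr_gt0 ?exprn_gt0 // ler_nat.
under eq_trunc => i _ do rewrite mem_setE.
exact: left_approximation_trunc_le HB _ _.
Qed.

Lemma subsequence_regaining (R : realType) (A : set nat)
    (B : nat -> {fset nat}) (s : nat -> nat) :
  left_approximation R A B -> computable s -> increasing_seq s ->
  infinite_set [set n : nat | A `&` `I_n = [set` B (s n)] `&` `I_n] ->
  regainingly_approximable (bin_value R A).
Proof.
move=> HB scomp sincr sinf; have [Bcomp BI Bhomo _] := HB.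
have truncE m k : trunc (fun i => i \in [set` B m]) k = trunc (fun i => i \in B m) k.
  by apply: eq_trunc => i _; rewrite mem_setE.
(* All elements of [B (s n.+1)] are below [s n.+1], so truncating at that length gives its exact
   value. *)
pose q n : rat := ((trunc (fun i => i \in B (s n.+1)) (s n.+1))%:R / (2 ^ s n.+1)%:R)%R.
have qE n : ratr (q n) = bin_value R [set` B (s n.+1)].
  by rewrite (bin_value_bounded R (BI _)) truncE fmorph_div /= !ratr_nat natrX.
have qhomo : nondecreasing_seq q.
  apply/nondecreasing_seqP => n; rewrite -(ler_rat R) !qE.
  apply: (nondecreasing_seqP _).1 Bhomo _ _ _.
  by have /increasing_seqP/(_ n.+1)/ltW := sincr.
exists q; split=> //.
- exists (fun=> 0), (fun n => trunc (fun i => i \in B (s n.+1)) (s n.+1)), (fun n => 2 ^ s n.+1).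
  have Hs : mu_computable (fun v : 1.-tuple nat => s (thead v).+1).
    exact: mu_computable_unary scomp (mu_computable_succ (mu_computable_head 0)).
  split.
  + exact/mu_computableP/mu_computable_cst.
  + exact/mu_computableP/strong_array_trunc.
  + by apply/mu_computableP/mu_computable_exp => //; exact: mu_computable_cst.
  + by move=> n; rewrite -lt0n expn_gt0.
  + by move=> n; rewrite expr0 mul1r.
- apply/cvgrPdist_le => /= e e0.
  (* Past [M] the stages agree with [A] on [k] digits, hence are [2 ^- k]-close; [s n.+1 >= n]
     brings the subsequence there. *)
  have [k _ /(_ k (leqnn k)) ke] := near_infty_natSinv_expn_lt (PosNum e0).
  have [M HM] := left_approximation_stable HB k.
  exists M => // n /= Mn; rewrite qE ger0_norm ?subr_ge0 ?left_approximation_bin_value_le //.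
  apply: le_trans (ltW ke); rewrite div1r; apply: bin_value_close.
  rewrite truncE HM //; apply: leq_trans Mn _.
  have sle m : m <= s m.
    elim: m => // m IH; apply: leq_ltn_trans IH _.
    by have /increasing_seqP/(_ m) := sincr; rewrite ltEnat.
  exact: leq_trans (leqnSn n) (sle _).
(* Asking for a match of length at least [n.+1] makes that length a successor [i.+1], and [q i] uses
   exactly this stage. *)
- apply/infinite_natP => n; have [[//|i] ni Hi] := (infinite_natP _).1 sinf n.+1.
  exists i => //=; rewrite qE; apply: le_lt_trans (_ : 2 ^- i.+1 < _)%R.
    by apply: bin_value_close; rewrite truncE; exact/trunc_eqP.
  by rewrite ltf_pV2 ?posrE ?exprn_gt0 // ltr_eXn2l // ltr1n.
Qed.

Theorem theorem4p2 (R : realType) (A : set nat)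
    (hA : left_computable (bin_value R A)) :
  [<-> regainingly_approximable (bin_value R A);
       exists B : nat -> {fset nat},
         left_approximation R A B /\
         infinite_set [set n : nat | A `&` `I_n = [set` B n]];
       forall B : nat -> {fset nat}, left_approximation R A B ->
         exists s : nat -> nat,
           [/\ computable s, increasing_seq s &
               infinite_set
                 [set n : nat | A `&` `I_n = [set` B (s n)] `&` `I_n]]].
Proof.
tfae.
- exact: regaining_left_approximation.
- by move=> [C [HC Cinf]] B; exact: regaining_subsequence HC Cinf.
- have [B HB] := left_computable_left_approximation hA.
  by move=> /(_ B HB) [s [scomp sincr sinf]]; exact: subsequence_regaining HB scomp sincr sinf.
Qed.
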